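(* Let $m\in\mathbb{N}$ and $n=m+1$. Then every eigenvalue of the pencil $\mathcal{A}_{m,n}(\lambda)=H_{m+n}-\lambda D_{m,n}$ is real and has geometric multiplicity $1$. The non-zero eigenvalues all have algebraic multiplicity $2$. The eigenvalue $0$ has algebraic multiplicity $1$ if $m$ is even and algebraic multiplicity $3$ if $m$ is odd.
   Context: $H_N$ is the real symmetric tridiagonal $N\times N$ matrix with entries $0$ on the diagonal, $1$ where $|r-s|=1$, and $0$ otherwise. $D_{m,n}$ is the $(m+n)\times(m+n)$ diagonal matrix whose first $m$ diagonal entries are $1$ and whose last $n$ diagonal entries are $-1$. A number $\lambda_0\in\mathbb{C}$ is an eigenvalue of the pencil $H-\lambda D$ if $H-\lambda_0 D$ is not invertible; its geometric multiplicity is the dimension of the kernel of $H-\lambda_0 D$, and its algebraic multiplicity is the order of the zero of the polynomial $\det(H-\lambda D)$ at $\lambda=\lambda_0$. *)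

(* Defs.v *)
From HB Require Import structures.
From mathcomp Require Import all_boot all_order all_algebra.
From mathcomp Require Import reals complex.

Set Implicit Arguments.
Unset Strict Implicit.
Unset Printing Implicit Defensive.

Import Order.TTheory GRing.Theory Num.Theory.
Local Open Scope ring_scope.

Definition Hmx (F : fieldType) (N : nat) : 'M[F]_N :=
  \matrix_(r < N, s < N) (if `|r - s|%N == 1%N then 1 else 0).

Definition Dmx (F : fieldType) (m n : nat) : 'M[F]_(m + n) :=
  diag_mx (\row_(r < m + n) (if (r < m)%N then 1 else -1)).

Definition pencil (F : fieldType) (N : nat) (H D : 'M[F]_N) (l : F) : 'M[F]_N :=
  H - l *: D.

Definition pencil_eigenvalue (F : fieldType) (N : nat) (H D : 'M[F]_N) (l : F) :
    bool :=
  pencil H D l \notin unitmx.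

(* kermx is the row kernel [u *m A = 0]; the transpose turns it into the
   kernel of A acting on column vectors. *)
Definition geom_mult (F : fieldType) (N : nat) (H D : 'M[F]_N) (l : F) : nat :=
  \rank (kermx (pencil H D l)^T).

Definition pencil_det (F : fieldType) (N : nat) (H D : 'M[F]_N) : {poly F} :=
  \det (map_mx polyC H - 'X *: map_mx polyC D).

Definition alg_mult (F : fieldType) (N : nat) (H D : 'M[F]_N) (l : F) : nat :=
  mup l (pencil_det H D).

(* Main.v *)
(* Let U_k be the Chebyshev polynomials of the second kind at l/2, so that
   det (H_k + l I) = U_k(l). Expanding along the first rows gives
   det (H - l D_{m,n}) = (-1)^m (U_m U_n + U_{m-1} U_{n-1}), which for n = m + 1
   collapses to (-1)^m l U_m(l)^2 by the three-term recurrence. The roots of U_m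
   are real, because Christoffel-Darboux at the points l and conj l reads
   0 = (l - conj l) * sum |U_k(l)|^2 with U_0 = 1, and they are simple, because
   its confluent form gives U_m'(l) U_{m-1}(l) = sum U_k(l)^2 > 0. Finally
   U_m(0) = 0 iff m is odd, and kernels of tridiagonal matrices with unit
   off-diagonal entries are at most one-dimensional. *)
Require Import Defs.
From HB Require Import structures.
From mathcomp Require Import all_boot all_order all_algebra.
From mathcomp Require Import reals complex.
From mathcomp Require Import ring zify.

Set Implicit Arguments.
Unset Strict Implicit.
Unset Printing Implicit Defensive.

Import Order.TTheory GRing.Theory Num.Theory.
Local Open Scope ring_scope.

(** The diagonal is an infinite sequence, so that deleting the first row and column amounts to the
    shift [a \o S]. *)
Definition tridiag (R : nzRingType) (a : nat -> R) (N : nat) : 'M[R]_N :=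
  \matrix_(i < N, j < N)
    (if i == j :> nat then a i else ((i.+1 == j) || (j.+1 == i))%:R).

Lemma det_tridiag0 (R : comNzRingType) (a : nat -> R) :
  \det (tridiag a 0) = 1.
Proof. exact: det_mx00. Qed.

Lemma det_tridiag1 (R : comNzRingType) (a : nat -> R) :
  \det (tridiag a 1) = a 0.
Proof. by rewrite det_mx11 mxE. Qed.

(** Only two entries of the first row can be non-zero, and the minor of the second has a single
    non-zero entry in its first column. *)
Lemma det_tridiagSS (R : comNzRingType) (a : nat -> R) (N : nat) :
  \det (tridiag a N.+2) =
    a 0 * \det (tridiag (a \o S) N.+1) - \det (tridiag (a \o S \o S) N).
Proof.
rewrite (expand_det_row _ ord0) !big_ord_recl /= big1 ?addr0; last first.
  by move=> i _; rewrite !mxE /= /bump /= ?add1n mul0r.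
rewrite /cofactor !mxE /= !expr0 !mul1r /bump /= addn0 expr1 mulN1r.
congr (_ * \det _ - _).
  by apply/matrixP=> i j; rewrite !mxE /= /bump /= ?add1n !eqSS.
rewrite (expand_det_col _ ord0) big_ord_recl /= big1 ?addr0; last first.
  by move=> i _; rewrite !mxE /= /bump /= ?add1n mul0r.
rewrite /cofactor !mxE /= expr0 !mul1r.
congr (\det _); apply/matrixP=> i j.
by rewrite !mxE /= /bump /= ?add1n !eqSS.
Qed.

(* The Chebyshev polynomial [U_{k-1}] at [x / 2]; the index shift makes room
   for [U_{-1} = 0]. *)
Fixpoint cheb (R : nzRingType) (x : R) (k : nat) : R :=
  match k with
  | 0 => 0
  | 1 => 1
  | (k'.+1 as k1).+1 => x * cheb x k1 - cheb x k'
  end.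

Arguments cheb : simpl never.

Lemma cheb0 (R : nzRingType) (x : R) : cheb x 0 = 0.
Proof. by []. Qed.

Lemma cheb1 (R : nzRingType) (x : R) : cheb x 1 = 1.
Proof. by []. Qed.

Lemma chebSS (R : nzRingType) (x : R) (k : nat) :
  cheb x k.+2 = x * cheb x k.+1 - cheb x k.
Proof. by []. Qed.

Lemma rmorph_cheb (R S : nzRingType) (f : {rmorphism R -> S}) (x : R) (k : nat) :
  f (cheb x k) = cheb (f x) k.
Proof.
(* The recurrence has order two, so the induction carries two consecutive indices. *)
suff: f (cheb x k) = cheb (f x) k /\ f (cheb x k.+1) = cheb (f x) k.+1 by case.
elim: k => [|k [IH1 IH2]]; first by rewrite !cheb0 !cheb1 rmorph0 rmorph1.
by split=> //; rewrite !chebSS rmorphB rmorphM IH1 IH2.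
Qed.

Lemma horner_cheb (R : comNzRingType) (x : R) (k : nat) :
  (cheb 'X k).[x] = cheb x k.
Proof. by rewrite -horner_evalE rmorph_cheb /= horner_evalE hornerX. Qed.

Definition sign_diag (R : nzRingType) (x : R) (m i : nat) : R :=
  if (i < m)%N then - x else x.

Lemma det_sign_tridiag (R : comNzRingType) (x : R) (m n : nat) :
  \det (tridiag (sign_diag x m) (m + n)) =
    (-1) ^+ m * (cheb x m.+1 * cheb x n.+1 + cheb x m * cheb x n).
Proof.
have det0 k : \det (tridiag (sign_diag x 0) k) = cheb x k.+1 /\
              \det (tridiag (sign_diag x 0) k.+1) = cheb x k.+2.
  elim: k => [|k [IH1 IH2]].
    by rewrite det_tridiag0 det_tridiag1 chebSS !cheb0 !cheb1 /sign_diag mulr1 subr0.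
  by split=> //; rewrite det_tridiagSS [RHS]chebSS -IH1 -IH2.
(* With [n] fixed, deleting the first row and column lowers [k] by one, as [sign_diag x k.+1 \o S]
   is [sign_diag x k]; so [f] obeys the recurrence of [cheb] at [- x]. *)
pose f k := \det (tridiag (sign_diag x k) (k + n)).
have f1 : f 1%N = - (x * cheb x n.+1 + cheb x n).
  rewrite /f; case: n {f} => [|n]; first by rewrite det_tridiag1 !cheb0 !cheb1 mulr1 addr0.
  by rewrite det_tridiagSS -(det0 n).1 -(det0 n).2 mulNr opprD.
have fSS k : f k.+2 = - x * f k.+1 - f k by rewrite /f det_tridiagSS.
suff: f m = (-1) ^+ m * (cheb x m.+1 * cheb x n.+1 + cheb x m * cheb x n) /\
      f m.+1 = (-1) ^+ m.+1 * (cheb x m.+2 * cheb x n.+1 + cheb x m.+1 * cheb x n).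
  by case.
elim: m => [|m [IH1 IH2]].
  by rewrite f1 /f (det0 n).1 !chebSS !cheb0 !cheb1; split; ring.
by split=> //; rewrite fSS IH1 IH2 !chebSS !exprS; ring.
Qed.

Lemma christoffel_darboux (R : comNzRingType) (x y : R) (n : nat) :
  cheb x n.+1 * cheb y n - cheb x n * cheb y n.+1 =
    (x - y) * \sum_(0 <= k < n.+1) cheb x k * cheb y k.
Proof.
elim: n => [|n IH]; first by rewrite big_nat1 !cheb0 !cheb1; ring.
by rewrite big_nat_recr // [RHS]mulrDr -IH !chebSS; ring.
Qed.

(** The confluent case y = x of [christoffel_darboux], obtained by a direct induction instead of a
    limit. *)
Lemma christoffel_darboux_deriv (R : comNzRingType) (n : nat) :
  (cheb 'X n.+1)^`() * cheb 'X n - (cheb 'X n)^`() * cheb 'X n.+1 =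
    \sum_(0 <= k < n.+1) cheb 'X k ^+ 2 :> {poly R}.
Proof.
elim: n => [|n IH].
  by rewrite big_nat1 !cheb0 !cheb1 derivC linear0; ring.
by rewrite !chebSS derivB derivM derivX big_nat_recr //= -IH; ring.
Qed.

Lemma cheb_root_real (C : numClosedFieldType) (x : C) (n : nat) :
  cheb x n.+1 = 0 -> x \is Num.real.
Proof.
move=> x0; apply/CrealP/eqP; rewrite eq_sym -subr_eq0.
have := christoffel_darboux x x^* n.
rewrite -!(rmorph_cheb Num.conj) x0 rmorph0 mul0r mulr0 subr0.
move=> /esym/eqP; rewrite mulf_eq0 => /orP[//|].
(* For [n = 0] the polynomial is the constant 1 and has no root; otherwise the sum of non-negative
   terms contains the index 1, whose term is 1. *)
case: n x0 => [|n] x0; first by move: x0 => /eqP; rewrite oner_eq0.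
rewrite psumr_eq0 => [/allP/(_ 1%N)|k _]; last first.
  by rewrite -rmorph_cheb mul_conjC_ge0.
by rewrite mem_index_iota /= mulr1 oner_eq0 => /(_ isT).
Qed.

Lemma cheb_deriv_root_neq0 (C : numClosedFieldType) (x : C) (n : nat) :
  cheb x n.+1 = 0 -> ~~ root (cheb 'X n.+1)^`() x.
Proof.
move=> x0; have xR := cheb_root_real x0.
apply/negP => /rootP dx0.
have := congr1 (horner^~ x) (christoffel_darboux_deriv C n).
rewrite /= hornerD hornerN !hornerM dx0 !horner_cheb x0 mul0r mulr0 subr0.
case: n x0 {dx0} => [|n] x0; first by move: x0 => /eqP; rewrite oner_eq0.
move/esym/eqP; rewrite horner_sum psumr_eq0 => [/allP/(_ 1%N)|k _].
  by rewrite mem_index_iota /= expr1n hornerC oner_eq0 => /(_ isT).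
(* The squares are non-negative because [x], hence [cheb x k], is real. *)
rewrite horner_exp horner_cheb real_exprn_even_ge0 //.
by rewrite CrealE rmorph_cheb /= (CrealP xR).
Qed.

(** A multiplicity of at least two would give p = q (X - x)^2, whose derivative vanishes at x. *)
Lemma mup_simple_root (F : fieldType) (p : {poly F}) (x : F) :
  root p x -> ~~ root p^`() x -> mup x p = 1%N.
Proof.
move=> px dpx.
have p0 : p != 0 by apply: contraNneq dpx => ->; rewrite linear0 root0.
apply/eqP; rewrite eqn_leq mup_leq // -XsubC_dvd // dvdp_XsubCl px andbT.
apply: contra dpx => /dvdpP[q ->].
by rewrite expr2 !derivM rootE !(hornerXsubC, hornerM, hornerD) subrr; apply/eqP; ring.
Qed.

Lemma size_cheb (R : comNzRingType) (n : nat) :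
  size (cheb 'X n.+1 : {poly R}) = n.+1.
Proof.
suff: size (cheb 'X n : {poly R}) = n /\ size (cheb 'X n.+1 : {poly R}) = n.+1.
  by case.
elim: n => [|n [IH1 IH2]]; first by rewrite !cheb0 !cheb1 size_poly0 size_poly1.
have cheb_neq0 : cheb 'X n.+1 != 0 :> {poly R} by rewrite -size_poly_eq0 IH2.
split=> //; rewrite chebSS mulrC size_polyDl size_mulX ?IH2 //.
by rewrite size_polyN IH1.
Qed.

Lemma cheb_neq0 (R : comNzRingType) (n : nat) : cheb 'X n.+1 != 0 :> {poly R}.
Proof. by rewrite -size_poly_eq0 size_cheb. Qed.

Lemma cheb_at0_eq0 (R : nzRingType) (n : nat) : (cheb (0 : R) n == 0) = ~~ odd n.
Proof.
suff: (cheb (0 : R) n == 0) = ~~ odd n /\ (cheb (0 : R) n.+1 == 0) = ~~ odd n.+1.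
  by case.
elim: n => [|n [IH1 IH2]]; first by rewrite !cheb0 !cheb1 eqxx oner_eq0.
by split=> //; rewrite chebSS mul0r sub0r oppr_eq0 IH1 /= negbK.
Qed.

(** Taking [f] to be the identity gives the pencil at a scalar; taking [polyC] gives the polynomial
    matrix behind [pencil_det]. *)
Lemma map_pencil_tridiag (F : fieldType) (R : comNzRingType)
    (f : {rmorphism F -> R}) (m n : nat) (x : R) :
  map_mx f (Hmx F (m + n)) - x *: map_mx f (Dmx F m n) =
    tridiag (sign_diag x m) (m + n).
Proof.
apply/matrixP=> i j; rewrite !mxE.
have -> : (i == j) = (i == j :> nat) by [].
have [ij|ij] := altP (nat_of_ord i =P j).
  rewrite ij subrr rmorph0 sub0r mulr1n /sign_diag.
  by case: ifP => _; rewrite ?rmorphN rmorph1 ?mulrN mulr1 ?opprK.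
have -> : (`|i - j|%N == 1%N) = (i.+1 == j) || (j.+1 == i) by lia.
by rewrite mulr0n rmorph0 mulr0 subr0; case: ifP; rewrite ?rmorph1 ?rmorph0.
Qed.

Lemma pencil_tridiag (F : fieldType) (m n : nat) (l : F) :
  pencil (Hmx F (m + n)) (Dmx F m n) l = tridiag (sign_diag l m) (m + n).
Proof. by rewrite -(map_pencil_tridiag idfun) !map_mx_id. Qed.

Lemma det_pencil (F : fieldType) (m n : nat) (l : F) :
  \det (pencil (Hmx F (m + n)) (Dmx F m n) l) =
    (-1) ^+ m * (cheb l m.+1 * cheb l n.+1 + cheb l m * cheb l n).
Proof. by rewrite pencil_tridiag det_sign_tridiag. Qed.

Lemma pencil_detE (F : fieldType) (m n : nat) :
  pencil_det (Hmx F (m + n)) (Dmx F m n) =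
    (-1) ^+ m * (cheb 'X m.+1 * cheb 'X n.+1 + cheb 'X m * cheb 'X n).
Proof. by rewrite -det_sign_tridiag -(map_pencil_tridiag polyC). Qed.

Lemma tridiag_ker0 (F : fieldType) (a : nat -> F) (N : nat) (u : 'rV[F]_N.+1) :
  u *m tridiag a N.+1 = 0 -> u 0 0 = 0 -> u = 0.
Proof.
move=> uT u0.
apply/rowP => -[k kN]; rewrite mxE.
elim/ltn_ind: k kN => -[|k] IH kN.
  by rewrite -[RHS]u0; congr (u _ _); apply: val_inj.
(* Column [k] of the product contains the coordinate [k.+1] of [u] with coefficient 1; earlier
   coordinates vanish by induction, later ones meet zero entries. *)
move/rowP/(_ (Ordinal (ltnW kN))): uT.
rewrite !mxE (bigD1 (Ordinal kN)) //= big1 ?addr0 => [|i].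
  by rewrite mxE /= gtn_eqF // eqxx orbT mulr1.
rewrite -val_eqE /= => ik.
have [ilek|kltI] := leqP i k.
  by case: i ilek {ik} => i iN ilek; rewrite IH ?mul0r.
rewrite mxE /= gtn_eqF // eq_sym (negbTE (_ : k.+1 != i)) 1?eq_sym //.
by rewrite orbF gtn_eqF ?mulr0 // ltnW.
Qed.

(** Multiplication by [delta_mx 0 0] reads off the first coordinate, which is injective on the
    kernel by [tridiag_ker0]. *)
Lemma rank_ker_tridiag (F : fieldType) (a : nat -> F) (N : nat) :
  (\rank (kermx (tridiag a N)) <= 1)%N.
Proof.
case: N => [|N]; first exact: leq_trans (rank_leq_row _) _.
rewrite -(mxrank_mul_ker _ (delta_mx 0 0 : 'cV[F]_N.+1)).
suff -> : (kermx (tridiag a N.+1) :&: kermx (delta_mx 0 0 : 'cV[F]_N.+1))%MS = 0.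
  by rewrite mxrank0 addn0 rank_leq_col.
apply/eqP; rewrite -submx0; apply/row_subP => i.
set u := row i _.
have := row_sub i (kermx (tridiag a N.+1) :&: kermx (delta_mx 0 0 : 'cV[F]_N.+1))%MS.
rewrite sub_capmx -/u => /andP[/sub_kermxP uT /sub_kermxP u0].
rewrite submx0; apply/eqP/(tridiag_ker0 uT).
by move/matrixP/(_ 0 0): u0; rewrite -colE !mxE.
Qed.

Lemma tridiag_tr (R : nzRingType) (a : nat -> R) (N : nat) :
  (tridiag a N)^T = tridiag a N.
Proof.
apply/matrixP => i j; rewrite !mxE eq_sym.
by case: eqP => [->|_] //; rewrite orbC.
Qed.

Theorem theorem6p1 (R : realType) (m n : nat) (hn : n = (m + 1)%N) :
  let H : 'M[R[i]%C]_(m + n) := Hmx _ (m + n) in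
  let D : 'M[R[i]%C]_(m + n) := Dmx _ m n in
  (forall l : R[i]%C, pencil_eigenvalue H D l ->
     l \is Num.real /\ geom_mult H D l = 1%N)
  /\ (forall l : R[i]%C, pencil_eigenvalue H D l -> l != 0 ->
        alg_mult H D l = 2%N)
  /\ (pencil_eigenvalue H D 0
      /\ (~~ odd m -> alg_mult H D 0 = 1%N)
      /\ (odd m -> alg_mult H D 0 = 3%N)).
Proof.
move: n hn => _ -> H D.
have pE : pencil_det H D = (-1) ^+ m * ('X * cheb 'X m.+1 ^+ 2).
  by rewrite pencil_detE addn1 chebSS; ring.
have eigE l : pencil_eigenvalue H D l = (l == 0) || (cheb l m.+1 == 0).
  rewrite /pencil_eigenvalue unitmxE unitfE negbK det_pencil addn1.
  rewrite [_ + _](_ : _ = l * cheb l m.+1 ^+ 2); last by rewrite chebSS; ring.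
  by rewrite !mulf_eq0 signr_eq0 orbb.
(* The factor ['X] contributes 1 at zero and the square contributes 2 at each root of
   [cheb 'X m.+1], all of them simple; for odd [m] both meet at zero. *)
have multE l : alg_mult H D l = ((l == 0%R) + (cheb l m.+1 == 0%R).*2)%N.
  have p0 := cheb_neq0 R[i]%C m.
  have -> : (cheb l m.+1 == 0) = root (cheb 'X m.+1) l by rewrite rootE horner_cheb.
  have mupX : mup l ('X : {poly R[i]%C}) = (l == 0).
    by rewrite -['X]subr0 -['X - 0]expr1 mup_XsubCX eq_sym; case: eqP.
  have mup_cheb : mup l (cheb 'X m.+1) = root (cheb 'X m.+1) l.
    case: (boolP (root _ l)) => [pl|]; last exact: mupNroot.
    rewrite mup_simple_root // cheb_deriv_root_neq0 //.
    by rewrite -horner_cheb; apply/rootP.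
  rewrite /alg_mult pE mupMr; last first.
    by rewrite rootE horner_exp hornerN hornerC signr_eq0.
  by rewrite mupM ?polyX_eq0 ?expf_neq0 // expr2 mupM // mupX mup_cheb addnn.
split=> [l eig|].
  split.
    by move: eig; rewrite eigE => /orP[/eqP->|/eqP/cheb_root_real//]; rewrite real0.
  apply/eqP; rewrite eqn_leq; apply/andP; split.
    by rewrite /geom_mult pencil_tridiag tridiag_tr rank_ker_tridiag.
  (* A singular matrix has deficient rank, so its kernel is non-zero. *)
  rewrite /geom_mult mxrank_ker subn_gt0 ltn_neqAle rank_leq_row andbT.
  by rewrite mxrank_tr -/(row_free _) row_free_unit.
split=> [l|].
  by rewrite eigE multE => /orP[->//|->] /negbTE->.
(* By the index shift, [cheb 0 m.+1] is U_m(0), so its vanishing means that [m] is odd. *)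
rewrite eigE eqxx multE eqxx cheb_at0_eq0 /= negbK.
by split=> //; split=> [/negbTE->|->].
Qed.
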